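(* Let $v_1,v_2$ be nonzero non-negative integers such that $\mathcal{U}=U_{\mathcal A}(v_1,v_2)$ is non-degenerate. Then, replacing if necessary $\mathcal U$ by its reflection $\{(y,x):(x,y)\in\mathcal U\}=U_{\mathcal A}(v_2,v_1)$ and $(v_1,v_2)$ by $(v_2,v_1)$, exactly one of the following holds: (1) $v_1,v_2\in2\mathbb{Z}\cap[4,\infty)$ and $\mathcal U$ is of $L$ type for $(v_1,v_2)$; (2) $v_1\in2\mathbb{Z}$, $v_2\in(1+2\mathbb{Z})\cap[4,\infty)$, and $\mathcal U$ is of column-deleted type for $(v_1,v_2)$; (3) $v_1\in2\mathbb{Z}\cap[4,\infty)$, $v_2=2$, and $\mathcal U$ is of column-deleted $L$ type for $(v_1,v_2)$; (4) $v_1\in2\mathbb{Z}$, $v_2=3$, and $\mathcal U$ is of shifted column-deleted type for $(v_1,v_2)$; (5) $v_1=v_2=2$ and $\mathcal U$ is of exceptional type.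
   Context: Fix a norm on $\mathbb{Z}^2$ increasing monotonically in each coordinate. For vectors $w_1,\dots,w_k\in\mathbb{Z}_{\ge0}^2$, the Ulam set $U(w_1,\dots,w_k)$ is built recursively: it starts with $w_1,\dots,w_k$, and at each step one adds a vector not yet in the set, of smallest norm among those that can be written as a sum of two distinct vectors of the current set in exactly one way (the resulting set is known not to depend on the choice of such norm or on tie-breaking). $U(w_1,\dots,w_k)$ is non-degenerate if $w_i\notin U(w_1,\dots,w_{i-1},w_{i+1},\dots,w_k)$ for each $i$. Let $\mathcal A=U((1,0),(0,1))$ and $U_{\mathcal A}(v_1,v_2)=U((1,0),(0,1),(v_1,v_2))$. Let $W_{(v_1,v_2)}=\{(m,n)\in\mathbb{Z}_{\ge0}^2: m<v_1\text{ or }n<v_2\}$ and $R=\{(m,1):m\in\mathbb{Z}_{\ge0}\}\cup\{(1,m):m\in\mathbb{Z}_{\ge0}\}$. For $U\subset\mathbb{Z}^2_{\ge0}$ and $(v_1,v_2)\in U$: $U$ is of $L$ type for $(v_1,v_2)$ if $U=\{(v_1,v_2)\}\cup R\cup\{(a+2mv_1,b+2mv_2): a,b,m\in\mathbb{Z}_{\ge0},\ a,b\text{ odd},\ (a,b)\in W_{(v_1,v_2)}\}$. $U$ is of column-deleted type for $(v_1,v_2)$ if $U=\{(v_1,v_2)\}\cup R\cup\{(2m+1,2n+1): m,n\in\mathbb{Z}_{\ge0},\ \text{if }2m+1=v_1+1\text{ then }2n+1<v_2\}$. $U$ is of column-deleted $L$ type for $(v_1,v_2)$ if $U=\{(v_1,v_2)\}\cup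 R\cup\{(a+(m+1)v_2+2,\ b+2m+5): a,b,m\in2\mathbb{Z}_{\ge0},\ a<m\text{ or }b=0\}$. $U$ is of shifted column-deleted type for $(v_1,v_2)$ if $U=\{(v_1,v_2)\}\cup R\cup\{(m,n): m,n\ge0,\ m<v_1,\ m,n\text{ odd}\}\cup\{(m,n): m,n\ge0,\ m>v_1,\ m\text{ even},\ n\text{ odd}\}$. $U$ is of exceptional type if $U=\{(v_1,v_2)\}\cup\{(8,8)\}\cup R\cup\{(4,2m+4):m\in\mathbb{Z}_{\ge0}\}\cup\{(2m+4,4):m\in\mathbb{Z}_{\ge0}\}$.
   Formalization: The printed column-deleted L type is false ((3,3) lies in U_A(4,2)); it is corrected to {(v1,v2)} ∪ R ∪ {(m,n): m<v1, m,n odd} ∪ {(a+(m+1)v1+2, b+2m+5): a,b,m even, a<v1 or b=0}. The norm is taken strictly increasing on the quadrant. *)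

(* Defs.v *)
From mathcomp Require Import all_boot all_order all_algebra.
From mathcomp Require Import classical_sets reals.
Set Implicit Arguments.
Unset Strict Implicit.
Unset Printing Implicit Defensive.
Import Order.TTheory GRing.Theory Num.Theory.
Local Open Scope classical_set_scope.
Local Open Scope ring_scope.

Record is_norm (R : realType) (N : int * int -> R) : Prop := IsNorm {
  norm_ge0 : forall z, 0 <= N z;
  norm_eq0 : forall z, N z = 0 <-> z = 0;
  norm_homogeneous : forall (k : int) z, N (z *~ k) = `|k|%:~R * N z;
  norm_triangle : forall z w, N (z + w) <= N z + N w
}.

(* A norm is even, so it can only be increasing on the quadrant.  The
   monotonicity is strict: for the sup norm the construction below depends on
   how ties are broken. *)
Definition increasing_in_each_coordinate (R : realType) (N : int * int -> R)
    : Prop :=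
  (forall x x' y : nat, (x < x')%N -> N (x%:Z, y%:Z) < N (x'%:Z, y%:Z)) /\
  (forall x y y' : nat, (y < y')%N -> N (x%:Z, y%:Z) < N (x%:Z, y'%:Z)).

(* Exactly one way means one unordered pair of distinct summands. *)
Definition uniquely_represented (S : set (nat * nat)) (w : nat * nat) : Prop :=
  exists x y : nat * nat,
    [/\ S x, S y, x <> y & x + y = w] /\
    (forall x' y' : nat * nat, S x' -> S y' -> x' <> y' -> x' + y' = w ->
       (x' = x /\ y' = y) \/ (x' = y /\ y' = x)).

Definition ulam_candidate (S : set (nat * nat)) (w : nat * nat) : Prop :=
  ~ S w /\ uniquely_represented S w.

(* Ties are left open.  The second disjunct only makes the stages an infinite
   sequence when the construction stops. *)
Definition ulam_step (R : realType) (N : int * int -> R)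
    (S S' : set (nat * nat)) : Prop :=
  (exists w : nat * nat,
     [/\ ulam_candidate S w,
         (forall w', ulam_candidate S w' ->
            N (w.1%:Z, w.2%:Z) <= N (w'.1%:Z, w'.2%:Z))
       & S' = S `|` [set w]]) \/
  ((forall w, ~ ulam_candidate S w) /\ S' = S).

(* [is_ulam_set N ws U]: some run of the construction from ws yields U. *)
Definition is_ulam_set (R : realType) (N : int * int -> R)
    (ws : seq (nat * nat)) (U : set (nat * nat)) : Prop :=
  exists stage : nat -> set (nat * nat),
    [/\ stage 0%N = [set w | w \in ws],
        (forall n, ulam_step N (stage n) (stage n.+1))
      & U = \bigcup_n stage n].

Definition ulam_nondegenerate (R : realType) (N : int * int -> R)
    (ws : seq (nat * nat)) : Prop :=
  forall i, (i < size ws)%N ->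
  forall U, is_ulam_set N (take i ws ++ drop i.+1 ws) U ->
  ~ U (nth (0, 0)%N ws i).

Definition UA_generators (v1 v2 : nat) : seq (nat * nat) :=
  [:: (1, 0); (0, 1); (v1, v2)]%N.

Definition reflection (U : set (nat * nat)) : set (nat * nat) :=
  [set z | U (z.2, z.1)].

Local Open Scope nat_scope.

Definition Wset (v1 v2 : nat) : set (nat * nat) :=
  [set z | z.1 < v1 \/ z.2 < v2].

Definition Rset : set (nat * nat) :=
  [set z | exists m, z = (m, 1)] `|` [set z | exists m, z = (1, m)].

Definition L_type (U : set (nat * nat)) (v1 v2 : nat) : Prop :=
  U = [set (v1, v2)] `|` Rset `|`
      [set z | exists a b m : nat, [/\ odd a, odd b, Wset v1 v2 (a, b)
                 & z = (a + 2 * m * v1, b + 2 * m * v2)]].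

Definition column_deleted_type (U : set (nat * nat)) (v1 v2 : nat) : Prop :=
  U = [set (v1, v2)] `|` Rset `|`
      [set z | exists m n : nat,
                 (2 * m + 1 = v1 + 1 -> 2 * n + 1 < v2) /\
                 z = (2 * m + 1, 2 * n + 1)].

(* The source prints
     {(v1,v2)} u Rset u {(a+(m+1)v2+2, b+2m+5) : a, b, m even, a < m or b = 0},
   which is not the Ulam set of any (v1, 2) with v1 >= 4 even: its points
   outside Rset and (v1,v2) have even abscissa, whereas (3,3) = (2,1) + (1,2) lies
   in U_A(v1,2).  Here v2 and the bound a < m are corrected to v1 and a < v1,
   and the odd columns to the left of v1 are restored. *)
Definition column_deleted_L_type (U : set (nat * nat)) (v1 v2 : nat) : Prop :=
  U = [set (v1, v2)] `|` Rset `|`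
      [set z | [/\ z.1 < v1, odd z.1 & odd z.2]] `|`
      [set z | exists a b m : nat,
                 [/\ ~~ odd a, ~~ odd b, ~~ odd m, a < v1 \/ b = 0
                   & z = (a + (m + 1) * v1 + 2, b + 2 * m + 5)]].

Definition shifted_column_deleted_type (U : set (nat * nat)) (v1 v2 : nat)
    : Prop :=
  U = [set (v1, v2)] `|` Rset `|`
      [set z | [/\ z.1 < v1, odd z.1 & odd z.2]] `|`
      [set z | [/\ v1 < z.1, ~~ odd z.1 & odd z.2]].

Definition exceptional_type (U : set (nat * nat)) (v1 v2 : nat) : Prop :=
  U = [set (v1, v2)] `|` [set (8, 8)] `|` Rset `|`
      [set z | exists m, z = (4, 2 * m + 4)] `|`
      [set z | exists m, z = (2 * m + 4, 4)].

Inductive ulam_case : Set :=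
  | CaseL
  | CaseColumnDeleted
  | CaseColumnDeletedL
  | CaseShiftedColumnDeleted
  | CaseExceptional.

Definition case_holds (U : set (nat * nat)) (v1 v2 : nat) (c : ulam_case)
    : Prop :=
  match c with
  | CaseL =>
      (~~ odd v1 /\ 4 <= v1) /\ (~~ odd v2 /\ 4 <= v2) /\ L_type U v1 v2
  | CaseColumnDeleted =>
      ~~ odd v1 /\ (odd v2 /\ 4 <= v2) /\ column_deleted_type U v1 v2
  | CaseColumnDeletedL =>
      (~~ odd v1 /\ 4 <= v1) /\ v2 = 2 /\ column_deleted_L_type U v1 v2
  | CaseShiftedColumnDeleted =>
      ~~ odd v1 /\ v2 = 3 /\ shifted_column_deleted_type U v1 v2
  | CaseExceptional =>
      (v1 = 2 /\ v2 = 2) /\ exceptional_type U v1 v2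
  end.

(* Main.v *)
(* Whatever the norm and the ties, an Ulam set U with generators ws is the only
   solution of "U w iff w is in ws or w is uniquely represented by U": a run
   adds points by nondecreasing norm, summands are strictly smaller than their
   sum, and only finitely many points lie below a given norm.  This makes the
   reflection immediate, and each case reduces to checking that an explicit set
   solves the equation.  Such a set is the two lines x = 1 and y = 1 together
   with inner points x, y >= 2.  A point (x, y) with x, y >= 3 always has the
   representation (x-1, 1) + (1, y-1), so it belongs to U iff row y-1 has no
   inner point at abscissa <= x, column x-1 has none at ordinate <= y, and
   (x, y) is not the sum of two distinct inner points.  Except for v = (2, 2),
   the inner points other than v all lie in odd rows, so that only sums with v
   as a summand matter. *)
Require Import Defs.
From mathcomp Require Import all_boot all_order all_algebra.
From mathcomp Require Import boolp classical_sets cardinality reals.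
From mathcomp Require Import zify.
Set Implicit Arguments.
Unset Strict Implicit.
Unset Printing Implicit Defensive.
Import Order.TTheory GRing.Theory Num.Theory.
Local Open Scope classical_set_scope.
Local Open Scope nat_scope.

Lemma finite_set_argmin d (R : orderType d) (T : choiceType) (f : T -> R)
    (A : set T) :
  finite_set A -> A !=set0 -> exists2 x, A x & forall y, A y -> (f x <= f y)%O.
Proof.
move=> /finite_seqP[s ->] [x0 /= sx0].
case: (arg_minP (fun i : seq_sub s => f (val i)) (isT : xpredT (SeqSub sx0))).
move=> i _ imin; exists (val i) => [|y /= sy]; first exact: valP.
exact: imin (SeqSub sy) _.
Qed.

(** * Unique representations *)

Definition representation (S : set (nat * nat)) (w p q : nat * nat) : Prop :=
  [/\ S p, S q, p <> q & (p + q)%R = w].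

Lemma representationC S w p q :
  representation S w p q -> representation S w q p.
Proof. by case=> Sp Sq pq <-; split=> //; [exact: nesym|rewrite addrC]. Qed.

Lemma sub_representation S T w p q : S `<=` T ->
  representation S w p q -> representation T w p q.
Proof. by move=> ST [/ST Tp /ST Tq pq pqw]; split. Qed.

Lemma representation_pairE S x y a b c d :
  representation S (x, y) (a, b) (c, d) <->
  [/\ S (a, b), S (c, d), a <> c \/ b <> d & a + c = x /\ b + d = y].
Proof.
split=> [[Sab Scd ne [<- <-]]|[Sab Scd ne [<- <-]]]; split=> //.
  have [ac|/eqP] := eqVneq a c; last by left.
  by right=> bd; apply: ne; rewrite ac bd.
by case=> ? ?; case: ne.
Qed.

Lemma uniquely_representedP S w p q : representation S w p q ->
  uniquely_represented S w <->
  forall p' q', representation S w p' q' -> p' = p \/ p' = q.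
Proof.
move=> [Sp Sq pq pqw]; split=> [[x [y [_ uniq]]] p' q' [Sp' Sq' pq' pqw']|uniq].
  have [[-> ->]|[-> ->]] := uniq _ _ Sp Sq pq pqw;
    have [[-> _]|[-> _]] := uniq _ _ Sp' Sq' pq' pqw'; by [left|right].
exists p, q; split=> // p' q' Sp' Sq' pq' pqw'.
have cancel_summand (u v v' : nat * nat) :
    (u + v)%R = w -> (u + v')%R = w -> v' = v.
  by case: u v v' => [a b] [c d] [c' d'] <- [? ?]; congr pair; lia.
have [|p'p|p'q] := uniq p' q'; first by split.
  by left; split=> //; apply: cancel_summand pqw _; rewrite -p'p.
right; split=> //; apply: (@cancel_summand q); first by rewrite addrC.
by rewrite -p'q.
Qed.

Lemma uniquely_represented_pairP S x y a b c d :
  S (a, b) -> S (c, d) -> a <> c \/ b <> d -> a + c = x -> b + d = y ->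
  uniquely_represented S (x, y) <->
  forall a' b' c' d', S (a', b') -> S (c', d') -> a' <> c' \/ b' <> d' ->
    a' + c' = x -> b' + d' = y -> a' = a /\ b' = b \/ a' = c /\ b' = d.
Proof.
move=> Sab Scd ne sumx sumy.
have rep : representation S (x, y) (a, b) (c, d) by apply/representation_pairE.
rewrite (uniquely_representedP rep); split=> [uniq a' b' c' d' ? ? ? ? ?|uniq].
  have [|[-> ->]|[-> ->]] := uniq (a', b') (c', d'); [|by left|by right].
  exact/representation_pairE.
move=> [a' b'] [c' d'] /representation_pairE[Sab' Scd' ne' [sumx' sumy']].
have [[-> ->]|[-> ->]] := uniq _ _ _ _ Sab' Scd' ne' sumx' sumy'; last by right.
by left.
Qed.

Lemma uniquely_represented_sub S T w p q : representation S w p q ->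
  (forall p' q', representation S w p' q' -> T p') ->
  uniquely_represented T w -> uniquely_represented S w.
Proof.
move=> repS ST.
have reps_in_T p' q' : representation S w p' q' -> representation T w p' q'.
  move=> repS'; have [_ _ pq' pqw'] := repS'.
  by split=> //; [exact: ST repS'|exact: ST (representationC repS')].
rewrite (uniquely_representedP (reps_in_T _ _ repS)) => uniq.
by apply/(uniquely_representedP repS) => p' q' /reps_in_T/uniq.
Qed.

Lemma exists_representation S w :
  uniquely_represented S w -> exists p q, representation S w p q.
Proof. by move=> [p [q []]]; exists p, q. Qed.

Lemma uniquely_represented_neq0 S w : uniquely_represented S w -> w <> (0, 0).
Proof.
case: w => x y /exists_representation[[a b] [[c d]]].
by rewrite representation_pairE => -[_ _ ? ?] [? ?]; lia.
Qed.

(** * Ulam sets as fixpoints *)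

Definition ulam_fixpoint (ws : seq (nat * nat)) (U : set (nat * nat)) : Prop :=
  forall w, U w <-> w \in ws \/ uniquely_represented U w.

Lemma representation_lt S x y a b c d : ~ S (0, 0) ->
  representation S (x, y) (a, b) (c, d) -> a + b < x + y.
Proof.
rewrite representation_pairE => S0 [_ Scd _ [<- <-]].
by case: c d Scd => [|c] [|d] // _; lia.
Qed.

Lemma ulam_fixpoint_neq0 ws U :
  (0, 0) \notin ws -> ulam_fixpoint ws U -> ~ U (0, 0).
Proof. by move=> /negP ws0 fixU /fixU[//|/uniquely_represented_neq0]. Qed.

Lemma uniquely_represented_local S T x y : ~ S (0, 0) -> ~ T (0, 0) ->
  (forall a b, a + b < x + y -> S (a, b) <-> T (a, b)) ->
  uniquely_represented S (x, y) -> uniquely_represented T (x, y).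
Proof.
move=> S0 T0 agree urS; have [[a b] [[c d] repS]] := exists_representation urS.
have repT : representation T (x, y) (a, b) (c, d).
  have [Sab Scd ? ?] := repS; split=> //; apply/agree => //.
    exact: representation_lt repS.
  exact: representation_lt (representationC repS).
apply: uniquely_represented_sub repT _ urS => -[a' b'] [c' d'] repT'.
have [Tab' _ _ _] := repT'; apply/agree => //.
exact: representation_lt repT'.
Qed.

Lemma ulam_fixpoint_unique ws U V : (0, 0) \notin ws ->
  ulam_fixpoint ws U -> ulam_fixpoint ws V -> U = V.
Proof.
move=> ws0 fixU fixV.
have [U0 V0] := (ulam_fixpoint_neq0 ws0 fixU, ulam_fixpoint_neq0 ws0 fixV).
suff agree n x y : x + y < n -> U (x, y) <-> V (x, y).
  by apply/seteqP; split=> -[x y]; apply agree with (x + y).+1.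
elim: n x y => // n IHn x y xyn.
have agree a b : a + b < x + y -> U (a, b) <-> V (a, b).
  by move=> abxy; apply: IHn; lia.
rewrite (fixU (x, y)) (fixV (x, y)); split=> -[|ur];
  [by left|right|by left|right].
  exact: uniquely_represented_local ur.
apply: uniquely_represented_local ur => // a b ab_lt.
by apply: iff_sym; exact: agree.
Qed.

Section Runs.
Variables (R : realType) (N : int * int -> R).
Local Notation nrm w := (N (Posz w.1, Posz w.2)).
Hypothesis nrm_lt_add : forall x y : nat * nat,
  y <> (0, 0) -> (nrm x < nrm (x + y)%R)%R.
Hypothesis finite_sublevel : forall c : R, finite_set [set w | (nrm w <= c)%R].

Lemma exists_ulam_step S : exists S', ulam_step N S S'.
Proof.
have [[w0 cand0]|no_cand] := pselect (exists w, ulam_candidate S w); last first.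
  by exists S; right; split=> // w cand; apply: no_cand; exists w.
pose A := [set w | ulam_candidate S w /\ (nrm w <= nrm w0)%R].
have [||w [cand _] wmin] := @finite_set_argmin _ _ _ (fun w => nrm w) A.
- by apply: sub_finite_set (finite_sublevel (nrm w0)) => w [].
- by exists w0.
exists (S `|` [set w]); left; exists w; split=> // w' cand'.
have [le|/ltW lt] := leP (nrm w') (nrm w0); first exact: wmin.
by apply: le_trans lt; exact: wmin.
Qed.

Lemma exists_ulam_set ws : exists U, is_ulam_set N ws U.
Proof.
have [next nextP] := choice exists_ulam_step.
pose stage n := iter n next [set w | w \in ws].
by exists (\bigcup_n stage n), stage; split=> // n; apply: nextP.
Qed.

Lemma representation_nrm_lt S w p q : ~ S (0, 0) ->
  representation S w p q -> (nrm p < nrm w)%R.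
Proof. by move=> S0 [_ Sq _ <-]; apply: nrm_lt_add => q0; rewrite q0 in Sq. Qed.

Section Run.
Variables (ws : seq (nat * nat)) (stage : nat -> set (nat * nat)).
Hypothesis ws_neq0 : (0, 0) \notin ws.
Hypothesis stage0 : stage 0 = [set w | w \in ws].
Hypothesis stageS : forall n, ulam_step N (stage n) (stage n.+1).

Lemma stage_sub m n : m <= n -> stage m `<=` stage n.
Proof.
elim: n => [|n IHn]; first by rewrite leqn0 => /eqP->.
rewrite leq_eqVlt => /orP[/eqP-> //|]; rewrite ltnS => /IHn mn w /mn nw.
by have [[u [_ _ ->]]|[_ ->]] := stageS n; first left.
Qed.

Lemma stage_neq0 n : ~ stage n (0, 0).
Proof.
elim: n => [|n IHn]; first by rewrite stage0 /=; apply/negP.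
have [[w [[_ /uniquely_represented_neq0 w0] _ ->]]|[_ ->]] := stageS n => //.
by case=> [//|/esym].
Qed.

(* The first new point of norm below c would have its summands in stage n, so
   it would already be a candidate there. *)
Lemma stage_stable_lt n (c : R) :
  (forall w, ulam_candidate (stage n) w -> (c <= nrm w)%R) ->
  forall m w, stage m w -> (nrm w < c)%R -> stage n w.
Proof.
move=> cand_ge; elim=> [|m IHm] w; first by move=> /(stage_sub (leq0n n)).
have [mn|nm] := ltnP m n; first by move=> /(stage_sub mn).
have [[u [[_ ur] _ ->]]|[_ ->]] := stageS m; last exact: IHm.
case=> [|->] uc; first exact: IHm.
have early p q : representation (stage m) u p q -> stage n p.
  move=> rep; have [mp _ _ _] := rep; apply: IHm mp _.
  by apply: lt_trans uc; exact: representation_nrm_lt (@stage_neq0 m) rep.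
have [p [q rep]] := exists_representation ur.
have rep_n : representation (stage n) u p q.
  have [_ _ pq pqu] := rep.
  by split=> //; [exact: early rep|exact: early (representationC rep)].
apply: contrapT => nu; suff: (c <= nrm u)%R by rewrite leNgt uc.
apply: cand_ge; split=> //.
apply: uniquely_represented_sub rep_n _ ur => p' q' [np' _ _ _].
exact: stage_sub np'.
Qed.

Lemma stage_generated m w : stage m w -> w \in ws \/
  exists n, ulam_candidate (stage n) w /\
    forall w', ulam_candidate (stage n) w' -> (nrm w <= nrm w')%R.
Proof.
elim: m => [|m IHm]; first by rewrite stage0; left.
have [[u [cand umin ->]]|[_ ->]] := stageS m; last exact: IHm.
by case=> [/IHm //|->]; right; exists m.
Qed.

(* While w stays a candidate, each step adds a new point of norm at most that
   of w, and there are finitely many of those. *)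
Lemma not_always_candidate n w :
  ~ forall m, n <= m -> ulam_candidate (stage m) w.
Proof.
move=> cand_w.
have /choice[added addedP] k : exists u, [/\ stage (n + k).+1 u,
    ~ stage (n + k) u & (nrm u <= nrm w)%R].
  have [[u [[nSu _] umin ->]]|[/(_ w)]] := stageS (n + k).
    by exists u; split=> //; [right|exact/umin/cand_w/leq_addr].
  by case; apply: cand_w; apply: leq_addr.
have not_added_before k l : k < l -> added k <> added l.
  move=> kl eq_kl; have [kk _ _] := addedP k; have [_ nl _] := addedP l.
  by apply: nl; rewrite -eq_kl; apply: stage_sub kk; rewrite ltn_add2l.
have added_inj : injective added.
  move=> k l eq_kl.
  by case: (ltngtP k l) => // /not_added_before; rewrite eq_kl.
have below_w : added @^-1` [set u | (nrm u <= nrm w)%R] = setT.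
  by apply/seteqP; split=> // k _; have [] := addedP k.
apply: infinite_nat; rewrite -below_w.
by apply: finite_preimage (finite_sublevel _) => k l _ _; exact: added_inj.
Qed.

Lemma run_ulam_fixpoint : ulam_fixpoint ws (\bigcup_n stage n).
Proof.
set U := \bigcup_n stage n.
have stageU n : stage n `<=` U by move=> w; exists n.
have U0 : ~ U (0, 0) by case=> n _; exact: stage_neq0.
move=> w; split=> [[m _ /stage_generated[|[n [[_ ur] wmin]]]]|[w_ws|ur]].
- by left.
- right; have [p [q rep]] := exists_representation ur.
  apply: uniquely_represented_sub (sub_representation (@stageU n) rep) _ ur.
  move=> p' q' rep'; have [[k _ kp'] _ _ _] := rep'.
  by apply: (stage_stable_lt wmin kp'); exact: representation_nrm_lt rep'.
- by exists 0 => //; rewrite stage0.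
have [p [q [[k _ kp] [l _ lq] pq pqw]]] := exists_representation ur.
apply: contrapT => nUw; apply: (@not_always_candidate (maxn k l) w) => m klm.
split=> [/stageU //|].
have rep : representation (stage m) w p q.
  by split=> //; [apply: stage_sub kp|apply: stage_sub lq]; lia.
by apply: uniquely_represented_sub rep _ ur => p' q' [/stageU].
Qed.

End Run.

Lemma is_ulam_setP ws U : (0, 0) \notin ws ->
  is_ulam_set N ws U <-> ulam_fixpoint ws U.
Proof.
move=> ws0; split=> [[stage [stage0 stageS ->]]|fixU].
  exact: run_ulam_fixpoint.
have [V ulamV] := exists_ulam_set ws.
have [stage [stage0 stageS VE]] := ulamV.
rewrite (ulam_fixpoint_unique ws0 fixU (_ : ulam_fixpoint ws V)) //.
by rewrite VE; apply: run_ulam_fixpoint.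
Qed.

End Runs.

Section IncreasingNorm.
Variables (R : realType) (N : int * int -> R).
Hypotheses (N_norm : is_norm N) (N_incr : increasing_in_each_coordinate N).
Local Notation nrm w := (N (Posz w.1, Posz w.2)).

Lemma norm_lt_add (x y : nat * nat) : y <> (0, 0) -> (nrm x < nrm (x + y)%R)%R.
Proof.
case: N_incr => incr1 incr2; case: x y => [a b] [c d] /= y0.
have [c0|c0] := posnP c; have [d0|d0] := posnP d.
- by case: y0; rewrite c0 d0.
- by rewrite c0 addr0; apply: incr2; rewrite -addn1 leq_add2l.
- by rewrite d0 addr0; apply: incr1; rewrite -addn1 leq_add2l.
apply: (@lt_trans _ _ (N (Posz (a + c), Posz b))).
  by apply: incr1; rewrite -addn1 leq_add2l.
by apply: incr2; rewrite -addn1 leq_add2l.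
Qed.

Lemma norm_le_add (x y : nat * nat) : (nrm x <= nrm (x + y)%R)%R.
Proof.
have [->|/eqP y0] := eqVneq y 0%R; first by rewrite addr0.
exact/ltW/norm_lt_add.
Qed.

Lemma norm_natmul (z : int * int) n : N (z *+ n)%R = (n%:R * N z)%R.
Proof. by rewrite -(norm_homogeneous N_norm n). Qed.

Lemma finite_norm_sublevel (c : R) : finite_set [set w | (nrm w <= c)%R].
Proof.
have multiple_le (w : nat * nat) n : w <> (0, 0) ->
    (N ((Posz w.1, Posz w.2) *+ n)%R <= c)%R -> n <= Num.bound (c / nrm w).
  move=> w0; have w_gt0 : (0 < nrm w)%R.
    exact: le_lt_trans (norm_ge0 N_norm 0%R) (norm_lt_add (0, 0) w0).
  rewrite norm_natmul -ler_pdivlMr // => n_le.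
  rewrite -(ler_nat R) ltW // (le_lt_trans n_le) // archi_boundP //.
  by rewrite (le_trans _ n_le).
pose bound e := (Num.bound (c / nrm e)).+1.
pose box := `I_(bound (1, 0)) `*` `I_(bound (0, 1)).
apply: (@sub_finite_set _ _ box); last by apply: finite_setX; exact: finite_II.
move=> [x y] /= w_le; split; rewrite /= ltnS; apply: multiple_le => //.
  rewrite pairMnE /= mul0rn natz (le_trans _ w_le) //.
  by have := norm_le_add (x, 0) (0, y); rewrite /= addr0.
rewrite pairMnE /= mul0rn natz (le_trans _ w_le) //.
by have := norm_le_add (0, y) (x, 0); rewrite /= addr0 add0r.
Qed.

Lemma norm_is_ulam_setP ws U : (0, 0) \notin ws ->
  is_ulam_set N ws U <-> ulam_fixpoint ws U.
Proof. exact: is_ulam_setP norm_lt_add finite_norm_sublevel _ _. Qed.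

End IncreasingNorm.

(** * Reflection *)

Lemma reflectionK : involutive reflection.
Proof. by move=> U; apply/seteqP; split=> -[x y]. Qed.

Lemma uniquely_represented_reflection U x y :
  uniquely_represented (reflection U) (x, y) <-> uniquely_represented U (y, x).
Proof.
have reflect_ur V x' y' : uniquely_represented V (y', x') ->
    uniquely_represented (reflection V) (x', y').
  move=> ur; have [[b a] [[d c] rep]] := exists_representation ur.
  have /representation_pairE[Vba Vdc ne [sumy sumx]] := rep.
  have uniq := (uniquely_represented_pairP Vba Vdc ne sumy sumx).1 ur.
  apply/(@uniquely_represented_pairP _ _ _ a b c d) => //; first lia.
  move=> a' b' c' d' Vba' Vdc' ne' sumx' sumy'.
  by have := uniq b' a' d' c' Vba' Vdc'; lia.
split=> [ur|]; last exact: reflect_ur.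
by rewrite -[U]reflectionK; apply: reflect_ur.
Qed.

Lemma ulam_fixpoint_reflection ws ws' U :
  (forall x y, ((x, y) \in ws') = ((y, x) \in ws)) ->
  ulam_fixpoint ws U -> ulam_fixpoint ws' (reflection U).
Proof.
by move=> ws'E fixU [x y]; rewrite ws'E uniquely_represented_reflection -fixU.
Qed.

(** * Sets made of two lines and isolated points *)

Definition cross_like (U : set (nat * nat)) : Prop :=
  Rset `<=` U /\ forall x y, U (x, y) -> x = 1 \/ y = 1 \/ 2 <= x /\ 2 <= y.

Lemma in_Rset x y : Rset (x, y) <-> x = 1 \/ y = 1.
Proof.
split=> [[[m [_ ->]]|[m [-> _]]]|[->|->]]; [by right|by left| |].
  by right; exists y.
by left; exists x.
Qed.

Lemma cross_like_col1 U : cross_like U -> forall y, U (1, y).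
Proof. by case=> RU _ y; apply/RU/in_Rset; left. Qed.

Lemma cross_like_row1 U : cross_like U -> forall x, U (x, 1).
Proof. by case=> RU _ x; apply/RU/in_Rset; right. Qed.

Lemma cross_like_reflection U : cross_like U -> cross_like (reflection U).
Proof.
move=> crossU; have [_ U_sub] := crossU.
split=> [[x y] /in_Rset xy|x y /U_sub /=]; last lia.
by case: xy => ->; [exact: cross_like_row1|exact: cross_like_col1].
Qed.

Lemma uniquely_represented_le2l U x y : cross_like U -> x <= 2 ->
  uniquely_represented U (x, y) <-> [&& 0 < x, 0 < y & (x == 1) || (y == 1)].
Proof.
move=> crossU x_le2; have [_ U_sub] := crossU.
have [col1 row1] := (cross_like_col1 crossU, cross_like_row1 crossU).
split=> [ur|/and3P[x0 y0 /orP[/eqP->|/eqP->]]].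
- have [x0 y0] : 0 < x /\ 0 < y.
    have [[a b] [[c d]]] := exists_representation ur.
    by move=> /representation_pairE[/U_sub ? /U_sub ?]; lia.
  have [x1|x1] := eqVneq x 1; first by rewrite x0 y0.
  have [y1|y1] := eqVneq y 1; first by rewrite x0 y0 orbT.
  (* Besides (1, 0) + (1, y), the point (2, y) is (0, 1) + (2, 1) or
     (1, 1) + (1, y - 1). *)
  have uniq := uniquely_represented_pairP (x := x) (y := y) (col1 0) (col1 y).
  rewrite uniq in ur; [|lia..]; have := ur _ _ _ _ (row1 0) (row1 x).
  by have := ur _ _ _ _ (col1 1) (col1 y.-1); lia.
- apply/(uniquely_represented_pairP (col1 y.-1) (row1 0)); [lia|lia|lia|].
  by move=> a b c d /U_sub ? /U_sub ?; lia.
apply/(uniquely_represented_pairP (row1 x.-1) (col1 0)); [lia|lia|lia|].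
by move=> a b c d /U_sub ? /U_sub ?; lia.
Qed.

Lemma uniquely_represented_le2r U x y : cross_like U -> y <= 2 ->
  uniquely_represented U (x, y) <-> [&& 0 < x, 0 < y & (x == 1) || (y == 1)].
Proof.
move=> /cross_like_reflection crossU y_le2.
rewrite -uniquely_represented_reflection.
rewrite (uniquely_represented_le2l _ crossU y_le2).
by rewrite andbCA [(y == 1) || _]orbC.
Qed.

Definition inner (I : nat -> nat -> Prop) (x y : nat) : Prop :=
  [/\ I x y, 2 <= x & 2 <= y].

Record isolated (I : nat -> nat -> Prop) (x y : nat) : Prop := Isolated {
  isolated_row : forall a, a <= x -> ~ inner I a y.-1;
  isolated_col : forall b, b <= y -> ~ inner I x.-1 b;
  isolated_sum : forall a b c d, inner I a b -> inner I c d ->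
    a + c = x -> b + d = y -> a = c /\ b = d
}.

Lemma uniquely_represented_isolated U x y : cross_like U -> 3 <= x -> 3 <= y ->
  uniquely_represented U (x, y) <-> isolated (fun a b => U (a, b)) x y.
Proof.
move=> crossU x3 y3; have [_ U_sub] := crossU.
have [col1 row1] := (cross_like_col1 crossU, cross_like_row1 crossU).
rewrite (uniquely_represented_pairP (row1 x.-1) (col1 y.-1)); [|lia..].
split=> [uniq|[row col sum] a b c d Uab Ucd ne sumx sumy].
  split=> [a ax [Ua a2 _]|b bx [Ub _ b2]|a b c d].
  - by have := uniq _ _ _ _ (row1 (x - a)) Ua; lia.
  - by have := uniq _ _ _ _ (col1 (y - b)) Ub; lia.
  move=> [Uab a2 b2] [Ucd c2 d2] sumx sumy.
  by have := uniq _ _ _ _ Uab Ucd; lia.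
have not_row p q : U (p, q) -> 2 <= p -> p <= x -> q <> y.-1.
  by move=> Up p2 px qy; case: (row p) => //; split=> //; [rewrite -qy|lia].
have not_col p q : U (p, q) -> 2 <= q -> q <= y -> p <> x.-1.
  by move=> Uq q2 qy px; case: (col q) => //; split=> //; [rewrite -px|lia].
have cd_cases := U_sub _ _ Ucd.
case: (U_sub _ _ Uab) => [a1|[b1|[a2 b2]]].
- by have := not_col _ _ Ucd; lia.
- by have := not_row _ _ Ucd; lia.
case: cd_cases => [c1|[d1|[c2 d2]]].
- by have := not_col _ _ Uab; lia.
- by have := not_row _ _ Uab; lia.
by have : a = c /\ b = d; [exact: sum|lia].
Qed.

Lemma cross_like_fixpoint (V : seq (nat * nat)) (U : set (nat * nat)) :
  cross_like U ->
  (forall x y, (x, y) \in V -> U (x, y)) ->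
  (forall x y, (x, y) \notin V -> U (x, y) ->
     x = 1 \/ y = 1 \/ 3 <= x /\ 3 <= y) ->
  (forall x y, 3 <= x -> 3 <= y -> (x, y) \notin V ->
     U (x, y) <-> isolated (fun a b => U (a, b)) x y) ->
  ulam_fixpoint [:: (1, 0), (0, 1) & V] U.
Proof.
move=> crossU VU U_sub U_isolated [x y].
have [col1 row1] := (cross_like_col1 crossU, cross_like_row1 crossU).
rewrite !in_cons !xpair_eqE; have [xyV|xyV] := boolP ((x, y) \in V).
  by split=> _; [left; rewrite !orbT|exact: VU].
have [x_le2|x3] := leqP x 2; last have [y_le2|y3] := leqP y 2.
- rewrite uniquely_represented_le2l //; split=> [/(U_sub _ _ xyV)|]; first lia.
  by move=> xy; have [->|->] : x = 1 \/ y = 1 by lia.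
- rewrite uniquely_represented_le2r //; split=> [/(U_sub _ _ xyV)|]; first lia.
  by move=> xy; have [->|->] : x = 1 \/ y = 1 by lia.
rewrite uniquely_represented_isolated // -U_isolated //; split; first by right.
by case=> //; lia.
Qed.

Definition cross (J : nat -> nat -> Prop) : set (nat * nat) :=
  Rset `|` [set z | J z.1 z.2].

Lemma in_cross J x y : cross J (x, y) <-> x = 1 \/ y = 1 \/ J x y.
Proof.
split=> [[/in_Rset[x1|y1]|Jxy]|[x1|[y1|Jxy]]].
- by left.
- by right; left.
- by do 2!right.
- by left; apply/in_Rset; left.
- by left; apply/in_Rset; right.
by right.
Qed.

Lemma inner_cross J x y : inner (fun a b => cross J (a, b)) x y <-> inner J x y.
Proof.
split=> [[/in_cross xy x2 y2]|[Jxy x2 y2]]; split=> //.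
  by case: xy => [|[|]] //; lia.
by apply/in_cross; do 2!right.
Qed.

Definition cross_with (v1 v2 : nat) (J : nat -> nat -> Prop) :
    set (nat * nat) :=
  [set (v1, v2)] `|` cross J.

Lemma in_cross_with v1 v2 J x y : cross_with v1 v2 J (x, y) <->
  x = v1 /\ y = v2 \/ x = 1 \/ y = 1 \/ J x y.
Proof.
by split=> [[[-> ->]|/in_cross]|[[-> ->]|/in_cross]];
  [left|right|left|right].
Qed.

Record isolated_with (v1 v2 : nat) (J : nat -> nat -> Prop) (x y : nat) :
  Prop := IsolatedWith {
    isolated_with_isolated : isolated J x y;
    isolated_with_row : y = v2.+1 -> x < v1;
    isolated_with_col : x = v1.+1 -> y < v2;
    isolated_with_sum : forall a b, inner J a b ->
      v1 + a = x -> v2 + b = y -> a = v1 /\ b = v2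
  }.

Lemma isolated_cross_with v1 v2 J x y : 2 <= v1 -> 2 <= v2 ->
  isolated (fun a b => cross_with v1 v2 J (a, b)) x y <->
  isolated_with v1 v2 J x y.
Proof.
move=> v1_ge2 v2_ge2; set I := fun a b => _.
have innerE a b : inner I a b <-> a = v1 /\ b = v2 \/ inner J a b.
  split=> [[[[-> ->]|Jab] a2 b2]|[[-> ->]|/inner_cross[Jab a2 b2]]].
  - by left.
  - by right; apply/inner_cross.
  - by split=> //; left.
  by split=> //; right.
have Iv : inner I v1 v2 by apply/innerE; left.
have JI a b : inner J a b -> inner I a b by move=> Jab; apply/innerE; right.
split=> [[row col sum]|[[row col sum] vrow vcol vsum]].
  split.
  - split=> [a ax /JI|b bx /JI|a b c d /JI Iab /JI];
      [exact: row|exact: col|exact: sum].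
  - move=> yv; rewrite ltnNge; apply/negP => vx.
    by apply: (row v1) => //; rewrite yv.
  - move=> xv; rewrite ltnNge; apply/negP => vy.
    by apply: (col v2) => //; rewrite xv.
  by move=> a b /JI Iab sumx sumy; have := sum _ _ _ _ Iv Iab sumx sumy; lia.
split=> [a ax /innerE[[av yv]|]|b bx /innerE[[xv bv]|]|a b c d].
- by have := vrow; lia.
- exact: row.
- by have := vcol; lia.
- exact: col.
move=> /innerE[[-> ->]|Jab] /innerE[[-> ->]|Jcd] // sumx sumy.
- by have := vsum _ _ Jcd sumx sumy; lia.
- by apply: vsum Jab _ _; rewrite addnC.
exact: sum sumx sumy.
Qed.

Lemma UA_generators_neq0 v1 v2 : v1 <> 0 -> (0, 0) \notin UA_generators v1 v2.
Proof. by move=> v1_neq0; rewrite !inE !xpair_eqE eq_sym /=; lia. Qed.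

Lemma UA_generators_swap v1 v2 x y :
  ((x, y) \in UA_generators v2 v1) = ((y, x) \in UA_generators v1 v2).
Proof. by rewrite !inE !xpair_eqE; lia. Qed.

Lemma ulam_fixpoint_cross_with v1 v2 (J : nat -> nat -> Prop) U :
  2 <= v1 -> 2 <= v2 ->
  (forall x y, J x y -> x = 1 \/ y = 1 \/ 3 <= x /\ 3 <= y) ->
  (forall x y, 3 <= x -> 3 <= y -> J x y <-> isolated_with v1 v2 J x y) ->
  ulam_fixpoint (UA_generators v1 v2) U -> U = cross_with v1 v2 J.
Proof.
move=> v1_ge2 v2_ge2 J_sub J_isolated fixU.
apply: ulam_fixpoint_unique fixU _; first by apply: UA_generators_neq0; lia.
apply: cross_like_fixpoint => [|x y|x y|x y x3 y3].
- split=> [z Rz|x y /in_cross_with[|[|[|/J_sub]]]]; try lia.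
  by right; left.
- by rewrite inE => /eqP[-> ->]; left.
- by rewrite inE xpair_eqE => xyv /in_cross_with[|[|[|/J_sub]]]; lia.
rewrite inE xpair_eqE isolated_cross_with // -J_isolated // in_cross_with.
by move=> xyv; split=> [[|[|[|]]]|]; [lia|lia|lia| |do 3!right].
Qed.

Lemma isolated_odd_rows (I : nat -> nat -> Prop) x y :
  (forall a b, I a b -> odd b) -> odd y ->
  (forall b, b <= y -> ~ inner I x.-1 b) -> isolated I x y.
Proof.
move=> I_odd y_odd col; split=> // [a _ [/I_odd]|a b c d]; first lia.
by move=> [/I_odd b_odd _ _] [/I_odd d_odd _ _]; lia.
Qed.

Definition both_odd (x y : nat) : Prop := odd x /\ odd y.

Lemma isolated_both_odd (I : nat -> nat -> Prop) x y :
  (forall a b, I a b -> both_odd a b) -> both_odd x y -> isolated I x y.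
Proof.
move=> I_odd [x_odd y_odd].
apply: isolated_odd_rows => // [a b /I_odd[] //|b _].
by move=> [/I_odd[]]; lia.
Qed.

Lemma base_ulam_fixpoint : ulam_fixpoint [:: (1, 0); (0, 1)] (cross both_odd).
Proof.
apply: cross_like_fixpoint => // [|x y _ /in_cross[|[|[]]]|x y x3 y3 _];
  try lia.
  by split=> [z|x y /in_cross[|[|[]]]]; [left|lia|lia|lia].
split=> [/in_cross xy|[row col _]].
  have xy_odd : both_odd x y by case: xy => [|[|]] //; lia.
  have [row col sum] : isolated both_odd x y by exact: isolated_both_odd.
  split=> [a ax /inner_cross|b bx /inner_cross|]; [exact: row|exact: col|].
  by move=> a b c d /inner_cross ? /inner_cross; apply: sum.
apply/in_cross; do 2!right; split; apply/negPn/negP => not_odd.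
  by apply: (col 3) => //; apply/inner_cross; split; [split; lia|lia|lia].
by apply: (row 3) => //; apply/inner_cross; split; [split; lia|lia|lia].
Qed.

(** * The five types *)

Definition column_deleted_points (v1 v2 x y : nat) : Prop :=
  both_odd x y /\ (x = v1.+1 -> y < v2).

Lemma column_deleted_points_isolated v1 v2 x y :
  ~~ odd v1 -> odd v2 -> 4 <= v2 -> 3 <= x -> 3 <= y ->
  column_deleted_points v1 v2 x y <->
  isolated_with v1 v2 (column_deleted_points v1 v2) x y.
Proof.
move=> v1_even v2_odd v2_ge4 x3 y3.
split=> [[[x_odd y_odd] del]|[[row col _] _ vcol _]].
  split=> [|||a b [[[_ b_odd] _] _ _]]; try lia.
  by apply: isolated_both_odd => // a b [].
have x_odd : odd x.
  apply/negPn/negP => x_even; apply: (col 3) => //; split; [|lia|lia].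
  by split; [split; lia|lia].
split=> //; split=> //; apply/negPn/negP => y_even.
apply: (row x) => //; split; [|lia|lia].
by split; [split; lia|move/vcol; lia].
Qed.

Lemma column_deleted_type_cross_with v1 v2 : ~~ odd v1 ->
  column_deleted_type (cross_with v1 v2 (column_deleted_points v1 v2)) v1 v2.
Proof.
move=> v1_even; rewrite /column_deleted_type /cross_with setUA.
congr (_ `|` _); apply/seteqP.
split=> [[x y] /= [[x_odd y_odd] del]|_ /= [m [n [del ->]]]].
  by exists x./2, y./2; split; [lia|congr pair; lia].
by split=> /=; [split; lia|lia].
Qed.

Lemma ulam_fixpoint_column_deleted_type v1 v2 U :
  2 <= v1 -> ~~ odd v1 -> 4 <= v2 -> odd v2 ->
  ulam_fixpoint (UA_generators v1 v2) U -> column_deleted_type U v1 v2.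
Proof.
move=> v1_ge2 v1_even v2_ge4 v2_odd fixU.
have -> : U = cross_with v1 v2 (column_deleted_points v1 v2).
  apply: ulam_fixpoint_cross_with fixU => // [|x y [[]]|x y]; try lia.
  exact: column_deleted_points_isolated.
exact: column_deleted_type_cross_with.
Qed.

Definition shifted_points (v1 x y : nat) : Prop :=
  odd y /\ (x < v1 /\ odd x \/ v1 < x /\ ~~ odd x).

Lemma shifted_points_isolated v1 x y : ~~ odd v1 -> 3 <= x -> 3 <= y ->
  shifted_points v1 x y <-> isolated_with v1 3 (shifted_points v1) x y.
Proof.
move=> v1_even x3 y3; split=> [[y_odd x_parity]|[[row col _] _ vcol _]].
  split=> [|||a b [[b_odd _] _ _]]; try lia.
  by apply: isolated_odd_rows => // [a b []|b _ [[_ ?] _ _]] //; lia.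
have x_parity : x < v1 /\ odd x \/ v1 < x /\ ~~ odd x.
  have : ~ (x.-1 < v1 /\ odd x.-1 \/ v1 < x.-1 /\ ~~ odd x.-1).
    by move=> pred_parity; apply: (col 3) => //; split; [split|lia|lia].
  lia.
split=> //; apply/negPn/negP => y_even; apply: (row x) => //.
by split; [split; lia|lia|lia].
Qed.

Lemma shifted_column_deleted_type_cross_with v1 v2 :
  shifted_column_deleted_type (cross_with v1 v2 (shifted_points v1)) v1 v2.
Proof.
rewrite /shifted_column_deleted_type /cross_with setUA -[RHS]setUA.
congr (_ `|` _); apply/seteqP; split=> -[x y] /=.
  by case=> y_odd [[xv x_odd]|[xv x_even]]; [left|right].
by case=> -[xv x_odd y_odd]; split=> //; [left|right].
Qed.

Lemma ulam_fixpoint_shifted_column_deleted_type v1 U : 2 <= v1 -> ~~ odd v1 ->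
  ulam_fixpoint (UA_generators v1 3) U -> shifted_column_deleted_type U v1 3.
Proof.
move=> v1_ge2 v1_even fixU; have -> : U = cross_with v1 3 (shifted_points v1).
  apply: ulam_fixpoint_cross_with fixU => // [x y []|x y]; first lia.
  exact: shifted_points_isolated.
exact: shifted_column_deleted_type_cross_with.
Qed.

Definition exceptional_points (x y : nat) : Prop :=
  x = 8 /\ y = 8 \/ x = 4 /\ 4 <= y /\ ~~ odd y \/ y = 4 /\ 4 <= x /\ ~~ odd x.

Lemma exceptional_points_isolated x y :
  exceptional_points x y -> isolated_with 2 2 exceptional_points x y.
Proof.
rewrite /exceptional_points => xy; split=> [|||a b [ab _ _]]; [|lia|lia|lia].
by split=> [a _ [ay _ _]|b _ [xb _ _]|a b c d [ab _ _] [cd _ _] sumx sumy]; lia.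
Qed.

Lemma isolated_exceptional_points x y : 3 <= x -> 3 <= y ->
  isolated_with 2 2 exceptional_points x y -> exceptional_points x y.
Proof.
move=> x3 y3 [[row col sum] vrow vcol vsum].
have col4 b : 4 <= b -> ~~ odd b -> inner exceptional_points 4 b.
  by split; [right; left|lia|lia].
have row4 a : 4 <= a -> ~~ odd a -> inner exceptional_points a 4.
  by split; [right; right|lia|lia].
have y_even : ~~ odd y.
  apply/negP => y_odd; have [y4|y_gt4] := leqP y 4; first by have := vrow; lia.
  by apply: (row 4); [lia|apply: col4; lia].
have x_even : ~~ odd x.
  apply/negP => x_odd; have [x4|x_gt4] := leqP x 4; first by have := vcol; lia.
  by apply: (col 4); [lia|apply: row4; lia].
rewrite /exceptional_points; have [x4|x_gt4] := leqP x 4; first lia.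
have [y4|y_gt4] := leqP y 4; first lia.
(* (6, y) is (2, 2) + (4, y - 2), and from (8, 8) on the two summands of
   (4, y - 4) + (x - 4, 4) are distinct unless x = y = 8. *)
have [x6|x_neq6] := eqVneq x 6.
  by have := vsum 4 (y - 2) (col4 _ _ _); lia.
have [y6|y_neq6] := eqVneq y 6.
  by have := vsum (x - 2) 4 (row4 _ _ _); lia.
by have := sum 4 (y - 4) (x - 4) 4 (col4 _ _ _) (row4 _ _ _); lia.
Qed.

Lemma exceptional_type_cross_with v1 v2 :
  exceptional_type (cross_with v1 v2 exceptional_points) v1 v2.
Proof.
rewrite /exceptional_type /cross_with setUA [_ `|` _ `|` Rset]setUAC.
rewrite -!(setUA ([set _] `|` Rset)).
congr (_ `|` _); apply/seteqP; split=> -[x y] /=.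
  case=> [[-> ->]|[[-> [y4 y_even]]|[-> [x4 x_even]]]];
    [by do 2!left|left; right|right].
    by exists (y - 4)./2; congr pair; lia.
  by exists (x - 4)./2; congr pair; lia.
by rewrite /exceptional_points; case=> [[[-> ->]|[m [-> ->]]]|[m [-> ->]]]; lia.
Qed.

Lemma ulam_fixpoint_exceptional_type U :
  ulam_fixpoint (UA_generators 2 2) U -> exceptional_type U 2 2.
Proof.
move=> fixU; have -> : U = cross_with 2 2 exceptional_points.
  apply: ulam_fixpoint_cross_with fixU => // x y.
    by rewrite /exceptional_points; lia.
  move=> x3 y3; split; first exact: exceptional_points_isolated.
  exact: isolated_exceptional_points.
exact: exceptional_type_cross_with.
Qed.

(* Translation by (p, q) raises the level by one, so the points of even level
   are exactly those that are not (p, q) plus a point of even level. *)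
Definition level (p q x y : nat) : nat := minn (x %/ p) (y %/ q).

Lemma levelS p q x y : 0 < p -> 0 < q -> p <= x -> q <= y ->
  level p q x y = (level p q (x - p) (y - q)).+1.
Proof.
move=> p0 q0 px qy; rewrite -{1}(subnK px) -{1}(subnK qy) /level.
by rewrite !divnDr // !divnn p0 q0 !addn1 minnSS.
Qed.

Lemma level_eq0 p q x y : x < p \/ y < q -> level p q x y = 0.
Proof.
by rewrite /level => -[/divn_small->|/divn_small->]; rewrite ?min0n ?minn0.
Qed.

Lemma levelP p q x y k : 0 < p -> 0 < q ->
  level p q x y = k <->
  exists a b, [/\ a < p \/ b < q, x = a + k * p & y = b + k * q].
Proof.
move=> p0 q0; have -> : level p q x y = k <->
    k * p <= x /\ k * q <= y /\ (x < k.+1 * p \/ y < k.+1 * q).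
  by rewrite -!leq_divRL // -!ltn_divLR // /level; lia.
rewrite !mulSn; split=> [[kx [ky kxy]]|[a [b [ab -> ->]]]]; last lia.
by exists (x - k * p), (y - k * q); split; lia.
Qed.

Definition L_points (v1 v2 x y : nat) : Prop :=
  both_odd x y /\ ~~ odd (level v1 v2 x y).

Section LType.
Variables v1 v2 : nat.
Hypotheses (v1_ge4 : 4 <= v1) (v1_even : ~~ odd v1).
Hypotheses (v2_ge4 : 4 <= v2) (v2_even : ~~ odd v2).

Lemma L_points_isolated x y :
  L_points v1 v2 x y -> isolated_with v1 v2 (L_points v1 v2) x y.
Proof.
move=> [[x_odd y_odd] lvl_even].
have lvl_sub : v1 <= x -> v2 <= y -> odd (level v1 v2 (x - v1) (y - v2)).
  by move=> vx vy; move: lvl_even; rewrite levelS /= ?negbK; lia.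
split.
- by apply: isolated_both_odd => // a b [].
- by move=> yv; have := lvl_sub; rewrite level_eq0; lia.
- by move=> xv; have := lvl_sub; rewrite level_eq0; lia.
move=> a b [[_ ab_even] _ _] sumx sumy.
by have := lvl_sub; rewrite -sumx -sumy !addKn; lia.
Qed.

Lemma isolated_L_points x y : 3 <= x -> 3 <= y ->
  isolated_with v1 v2 (L_points v1 v2) x y -> L_points v1 v2 x y.
Proof.
move=> x3 y3 [[row col _] vrow vcol vsum].
have inner_points a b : both_odd a b -> ~~ odd (level v1 v2 a b) ->
  2 <= a -> 2 <= b -> inner (L_points v1 v2) a b by [].
have x_odd : odd x.
  apply/negPn/negP => x_even; apply: (col 3) => //.
  by apply: inner_points; rewrite ?level_eq0; [split|..]; lia.
have y_odd : odd y.
  apply/negPn/negP => y_even; apply: (row 3) => //.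
  by apply: inner_points; rewrite ?level_eq0; [split|..]; lia.
split=> //; have [xv|xv] := ltnP x v1; first by rewrite level_eq0 //; left.
have [yv|yv] := ltnP y v2; first by rewrite level_eq0 //; right.
rewrite levelS ?negbK /=; [|lia..]; apply/negPn/negP => lvl_even.
have sub_odd : both_odd (x - v1) (y - v2) by split; lia.
by have := vsum _ _ (inner_points _ _ sub_odd lvl_even _ _); lia.
Qed.

Lemma L_type_cross_with : L_type (cross_with v1 v2 (L_points v1 v2)) v1 v2.
Proof.
have [v1_gt0 v2_gt0] : 0 < v1 /\ 0 < v2 by lia.
rewrite /L_type /cross_with setUA; congr (_ `|` _); apply/seteqP.
split=> [[x y] /= [[x_odd y_odd] lvl]|_ /= [a [b [m [a_odd b_odd /= ab ->]]]]].
  have [a [b [ab xE yE]]] := (levelP x y _ v1_gt0 v2_gt0).1 erefl.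
  rewrite -[level _ _ _ _]even_halfK // -muln2 mulnC in xE yE.
  by exists a, b, (level v1 v2 x y)./2; split; [| |exact: ab|congr pair]; lia.
have lvlE : level v1 v2 (a + 2 * m * v1) (b + 2 * m * v2) = 2 * m.
  by apply/levelP => //; exists a, b.
by split; [split|]; rewrite /= ?lvlE; lia.
Qed.

Lemma ulam_fixpoint_L_type U :
  ulam_fixpoint (UA_generators v1 v2) U -> L_type U v1 v2.
Proof.
move=> fixU; have -> : U = cross_with v1 v2 (L_points v1 v2).
  apply: ulam_fixpoint_cross_with fixU => [||x y [[]]|x y x3 y3]; try lia.
  by split; [exact: L_points_isolated|exact: isolated_L_points].
exact: L_type_cross_with.
Qed.

End LType.

Definition column_deleted_L_level (v1 x y : nat) : nat :=
  level v1 2 (x - (v1 + 2)) (y - 5).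

Definition column_deleted_L_points (v1 x y : nat) : Prop :=
  x < v1 /\ both_odd x y \/
  [/\ v1 + 2 <= x, 5 <= y, ~~ odd x, odd y
    & ~~ odd (column_deleted_L_level v1 x y)].

Section ColumnDeletedLType.
Variable v1 : nat.
Hypotheses (v1_ge4 : 4 <= v1) (v1_even : ~~ odd v1).
Local Notation lvl := (column_deleted_L_level v1).
Local Notation points := (column_deleted_L_points v1).

Lemma column_deleted_L_levelS x y : v1 + 2 + v1 <= x -> 7 <= y ->
  lvl x y = (lvl (x - v1) (y - 2)).+1.
Proof.
move=> vx y7; rewrite /column_deleted_L_level levelS; [|lia..].
by congr (level _ _ _ _).+1; lia.
Qed.

Lemma column_deleted_L_level_eq0 x y :
  x < v1 + 2 + v1 \/ y < 7 -> lvl x y = 0.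
Proof. by move=> xy; apply: level_eq0; lia. Qed.

Lemma column_deleted_L_points_isolated x y : 3 <= x -> 3 <= y ->
  points x y -> isolated_with v1 2 points x y.
Proof.
move=> x3 y3 Pxy.
have odd_row a b : points a b -> odd b by case=> [[_ []]|[]].
split=> [|yv|xv|a b [Pab a2 b2] sumx sumy].
- apply: isolated_odd_rows (odd_row _ _ Pxy) _ => // b _ [Pxb _ _].
  by case: Pxy => [[xv [x_odd _]]|[xv _ x_even _ _]];
    case: Pxb => [[? []]|[]]; lia.
- by case: Pxy => [[]|[]]; lia.
- by case: Pxy => [[? []]|[]]; lia.
case: Pxy => [[]|[vx _ x_even _ xy_even]]; first lia.
case: Pab => [[? []]|[va b5 _ _ ab_even]]; first lia.
move: xy_even; rewrite column_deleted_L_levelS -?sumx -?sumy ?addKn /=; lia.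
Qed.

Lemma isolated_column_deleted_L_points x y : 3 <= x -> 3 <= y ->
  isolated_with v1 2 points x y -> points x y.
Proof.
move=> x3 y3 [[row col _] vrow vcol vsum].
have inner_left a b : odd a -> odd b -> a < v1 -> 2 <= a -> 2 <= b ->
    inner points a b.
  by split=> //; left.
have inner_right a b : v1 + 2 <= a -> 5 <= b -> ~~ odd a -> odd b ->
    ~~ odd (lvl a b) -> inner points a b.
  by split; [right|lia|lia].
have y_odd : odd y.
  by apply/negPn/negP => y_even; apply: (row 3) => //; apply: inner_left; lia.
have x_odd : x <= v1 -> odd x.
  move=> xv; apply/negPn/negP => x_even.
  by apply: (col 3) => //; apply: inner_left; lia.
have [xv|xv] := ltnP x v1.
  by left; split=> //; split=> //; apply: x_odd; lia.
have y5 : 5 <= y by have := vrow; lia.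
have xv2 : v1 + 2 <= x by have := vcol; lia.
have x_even : ~~ odd x.
  apply/negP => x_odd'; apply: (col 5) => //.
  by apply: inner_right; rewrite ?column_deleted_L_level_eq0; lia.
right; split=> //; have [vx|vx] := leqP (v1 + 2 + v1) x; last first.
  by rewrite column_deleted_L_level_eq0 //; left.
have [y7|y7] := leqP 7 y; last by rewrite column_deleted_L_level_eq0 //; right.
rewrite column_deleted_L_levelS //= negbK; apply/negPn/negP => sub_even.
by have := vsum _ _ (inner_right _ _ _ _ _ _ sub_even); lia.
Qed.

Lemma column_deleted_L_type_cross_with :
  column_deleted_L_type (cross_with v1 2 points) v1 2.
Proof.
rewrite /column_deleted_L_type /cross_with setUA -[RHS]setUA.
have v1_gt0 : 0 < v1 by lia.
congr (_ `|` _); apply/seteqP.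
split=> -[x y] /= [[xv xy_odd]|]; [by left; case: xy_odd| |by left|].
  move=> [xv y5 x_even y_odd lvl_even].
  have [a [b [ab]]] :=
    (levelP (x - (v1 + 2)) (y - 5) _ v1_gt0 (ltn0Sn 1)).1 erefl.
  move: lvl_even; rewrite /column_deleted_L_level.
  set k := level _ _ _ _ => k_even xE yE.
  have kv_even : ~~ odd (k * v1) by rewrite oddM (negPf k_even).
  right; exists a, b, k; rewrite mulnDl.
  by split; [lia|lia|lia|lia|congr pair; lia].
move=> [a [b [m [a_even b_even m_even ab [-> ->]]]]]; right.
have mv_even : ~~ odd (m * v1) by rewrite oddM (negPf m_even).
have -> : a + (m + 1) * v1 + 2 = v1 + 2 + (a + m * v1) by lia.
have -> : b + 2 * m + 5 = 5 + (b + m * 2) by lia.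
have lvlE : lvl (v1 + 2 + (a + m * v1)) (5 + (b + m * 2)) = m.
  rewrite /column_deleted_L_level !addKn; apply/levelP => //.
  by exists a, b; split=> //; lia.
by split; rewrite ?lvlE; lia.
Qed.

Lemma ulam_fixpoint_column_deleted_L_type U :
  ulam_fixpoint (UA_generators v1 2) U -> column_deleted_L_type U v1 2.
Proof.
move=> fixU; have -> : U = cross_with v1 2 points.
  apply: ulam_fixpoint_cross_with fixU => // [|x y|x y x3 y3]; first lia.
    by case=> [[_ []]|[]]; lia.
  split; first exact: column_deleted_L_points_isolated.
  exact: isolated_column_deleted_L_points.
exact: column_deleted_L_type_cross_with.
Qed.

End ColumnDeletedLType.

Lemma case_holds_inj U v1 v2 c c' :
  case_holds U v1 v2 c -> case_holds U v1 v2 c' -> c = c'.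
Proof. by case: c; case: c' => //= -[? ?] [? ?]; lia. Qed.

Lemma exists_case_holds U v1 v2 : 2 <= v1 -> 2 <= v2 -> ~~ odd v1 ->
  [|| odd v2, v2 == 2 | 4 <= v1] -> ulam_fixpoint (UA_generators v1 v2) U ->
  exists c, case_holds U v1 v2 c.
Proof.
move=> v1_ge2 v2_ge2 v1_even v12 fixU.
have [v2_odd|v2_even] := boolP (odd v2).
  have [v2E|v2_neq3] := eqVneq v2 3.
    rewrite v2E in fixU *; exists CaseShiftedColumnDeleted; do 2!split=> //.
    exact: ulam_fixpoint_shifted_column_deleted_type.
  have v2_ge4 : 4 <= v2 by lia.
  exists CaseColumnDeleted; do 2!split=> //.
  exact: ulam_fixpoint_column_deleted_type.
have [v2E|v2_neq2] := eqVneq v2 2; rewrite ?v2E in fixU *.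
  have [v1E|v1_neq2] := eqVneq v1 2.
    rewrite v1E in fixU *; exists CaseExceptional; split=> //.
    exact: ulam_fixpoint_exceptional_type.
  have v1_ge4 : 4 <= v1 by lia.
  exists CaseColumnDeletedL; do 2!split=> //.
  exact: ulam_fixpoint_column_deleted_L_type.
have [v1_ge4 v2_ge4] : 4 <= v1 /\ 4 <= v2 by lia.
by exists CaseL; do 2!split=> //; exact: ulam_fixpoint_L_type.
Qed.

Lemma exists_unique_case_holds U v1 v2 : 2 <= v1 -> 2 <= v2 -> ~~ odd v1 ->
  [|| odd v2, v2 == 2 | 4 <= v1] -> ulam_fixpoint (UA_generators v1 v2) U ->
  exists! c, case_holds U v1 v2 c.
Proof.
move=> v1_ge2 v2_ge2 v1_even v12 fixU.
have [c c_holds] := exists_case_holds v1_ge2 v2_ge2 v1_even v12 fixU.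
by exists c; split=> // c'; exact: case_holds_inj.
Qed.

Lemma nondegenerate_notin_cross (R : realType) (N : int * int -> R) v1 v2 :
  is_norm N -> increasing_in_each_coordinate N ->
  ulam_nondegenerate N (UA_generators v1 v2) -> ~ cross both_odd (v1, v2).
Proof.
move=> N_norm N_incr nondeg; apply: (nondeg 2) => //.
by apply/(norm_is_ulam_setP N_norm N_incr) => //; exact: base_ulam_fixpoint.
Qed.

Theorem theorem5p3 (R : realType) (N : int * int -> R)
    (N_norm : is_norm N) (N_incr : increasing_in_each_coordinate N)
    (v1 v2 : nat) (v1_neq0 : v1 <> 0) (v2_neq0 : v2 <> 0)
    (U : set (nat * nat)) (U_ulam : is_ulam_set N (UA_generators v1 v2) U)
    (nondeg : ulam_nondegenerate N (UA_generators v1 v2)) :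
  is_ulam_set N (UA_generators v2 v1) (reflection U) /\
  ((exists! c : ulam_case, case_holds U v1 v2 c) \/
   (exists! c : ulam_case, case_holds (reflection U) v2 v1 c)).
Proof.
have ulamP w1 w2 W : w1 <> 0 -> is_ulam_set N (UA_generators w1 w2) W <->
    ulam_fixpoint (UA_generators w1 w2) W.
  by move=> w1_neq0; apply: norm_is_ulam_setP => //; exact: UA_generators_neq0.
have fixU := (ulamP _ _ _ v1_neq0).1 U_ulam.
have fixU' := ulam_fixpoint_reflection (UA_generators_swap v1 v2) fixU.
split; first exact/ulamP.
have := nondegenerate_notin_cross N_norm N_incr nondeg.
rewrite in_cross /both_odd => v_notin_base.
have [v12|v12] := boolP (~~ odd v1 && [|| odd v2, v2 == 2 | 4 <= v1]).
  by left; apply: exists_unique_case_holds fixU; lia.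
by right; apply: exists_unique_case_holds fixU'; lia.
Qed.
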